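(* For each infinite cardinal $\kappa$ there is a $\mathcal C(\kappa)$-space that can be simultaneously partitioned into countably many dense hereditarily $\kappa$-resolvable subspaces and also into $\mu$ many dense submaximal (and therefore hereditarily irresolvable) subspaces for all infinite $\mu\le\kappa$.
   Context: For a space $X$, $\Delta(X)$ is the minimum cardinality of a nonempty open subset of $X$, and $\operatorname{nwd}(X)$ is the minimum cardinality of a somewhere dense (i.e. not nowhere dense) subset of $X$. $X$ is NODEC if all nowhere dense subsets of $X$ are closed (hence closed discrete). $D(2)$ is the discrete two-point space. For an infinite cardinal $\kappa$, a $\mathcal C(\kappa)$-space is a dense NODEC subspace $X$ of the Cantor cube $D(2)^{2^\kappa}$ with $|X|=\operatorname{nwd}(X)=\Delta(X)=\kappa$. A space is $\kappa$-resolvable if it contains $\kappa$ many pairwise disjoint dense subsets; it is irresolvable if it is not $2$-resolvable. A space is crowded if it has no isolated points. A space is hereditarily $\kappa$-resolvable if all of its (nonempty) crowded subspaces are $\kappa$-resolvable, and hereditarily irresolvable if all of its (nonempty) subspaces are irresolvable. A space is submaximal if all of its dense subsets are open. *)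

(* Defs.v *)
(* Cardinals are represented by types (or sets), compared
   with the library's [#<=] and [#=]; a subspace is a set [A : set T] seen as
   the topological space [set_type A] (initial topology of the inclusion). *)
From HB Require Import structures.
From mathcomp Require Import all_boot all_order all_algebra.
From mathcomp Require Import all_classical.
From mathcomp Require Import topology.

Set Implicit Arguments.
Unset Strict Implicit.
Unset Printing Implicit Defensive.

Local Open Scope classical_set_scope.
Local Open Scope card_scope.

(* D(2)^I; [bool] carries the discrete topology. *)
Definition cantor_cube (I : Type) : topologicalType :=
  prod_topology (fun _ : I => bool).

(* The minimum of the cardinalities of the members of [F] exists and is |K|. *)
Definition is_min_card (T : Type) (F : set (set T)) (K : Type) : Prop :=
  (exists2 A, F A & A #= [set: K]) /\ (forall A, F A -> [set: K] #<= A).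

Section TopologicalNotions.
Variable T : topologicalType.

Definition nowhere_dense (A : set T) : Prop := interior (closure A) = set0.

Definition nodec : Prop := forall A : set T, nowhere_dense A -> closed A.

(* Delta(T) = |K| *)
Definition dispersion_is (K : Type) : Prop :=
  is_min_card [set U : set T | open U /\ U !=set0] K.

(* nwd(T) = |K| *)
Definition nwd_is (K : Type) : Prop :=
  is_min_card [set A : set T | ~ nowhere_dense A] K.

Definition crowded : Prop := isolated [set: T] = set0.

Definition resolvable (K : Type) : Prop :=
  exists D : K -> set T, (forall k, dense (D k)) /\ trivIset setT D.

Definition irresolvable : Prop := ~ resolvable bool.

Definition submaximal : Prop := forall D : set T, dense D -> open D.

End TopologicalNotions.

Definition hereditarily_resolvable (T : topologicalType) (K : Type) : Prop :=
  forall A : set T, A !=set0 -> crowded (set_type A) ->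
    resolvable (set_type A) K.

Definition hereditarily_irresolvable (T : topologicalType) : Prop :=
  forall A : set T, A !=set0 -> irresolvable (set_type A).

(* The index set [set K] is the power set of K, of cardinality 2^|K|. *)
Definition C_space (K : Type) (X : set (cantor_cube (set K))) : Prop :=
  [/\ dense X,
      nodec (set_type X),
      X #= [set: K],
      nwd_is (set_type X) K &
      dispersion_is (set_type X) K].

(* Main.v *)
Require Import Defs.
From mathcomp Require Import all_boot.
From mathcomp Require Import all_classical.
From mathcomp Require Import topology.

(** The proof builds the topology in one step, by Zorn's lemma.

    Start from a set [S] of cardinality |K| carrying an independent family
    [b i], [i : set K], of two-set partitions (Fichtenholz-Kantorovich), and
    from a family [D j] of subsets of [S] that meet every box (every finite
    Boolean combination of the [b i]) in a large set. Among the ideals on [S]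
    that contain all sets of cardinality less than |K| and contain no
    intersection of a box with some [D j], take a maximal one, [N]. Then alter
    the partitions: the index [i] codes a pair [(A, B)] of subsets of [S], and
    if both are in [N], the first half of [b i] gains [B] and loses
    [A \ B] (lemma [ex_forced]). Each partition changes only on a set of [N],
    so boxes change only modulo [N] and every [D j] remains dense; but now the
    members of [N] are closed and discrete, since a point can be separated from
    the rest of any such set. Conversely, by maximality a set [A] outside [N]
    contains a box intersected with some [D j], up to a set of [N], so [A] is
    somewhere dense. Hence [N] consists exactly of the nowhere dense sets, the
    space is nodec, and what a somewhere dense set looks like is governed by
    the sets [D j]: up to nowhere dense sets, locally it contains one of them.

    The sets [D j] are chosen as follows. A point has a kind in [K + nat], a
    level in [nat] and a finite sequence over [K] (its tail), besides the data
    used by the independent family. For [k : K] there is one set [D j], the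
    points of kind [k]. For [n : nat] there is a whole tree of sets: the points
    of kind [n] whose tail starts with a prescribed [s : seq K]; every node of
    the tree contains |K| disjoint children. If a subspace lies in one of the
    former sets, its somewhere dense parts locally contain this very set up to
    a nowhere dense, hence closed, remainder: this gives submaximality
    ([submaximal_of_single]). If it lies in the root of a tree, its nonempty
    open parts, when it is crowded, contain a node of the tree locally and so
    its |K| disjoint dense children; a maximality argument glues these local
    resolutions ([resolvable_of_split]).

    Finally, the set of points of a given level is put in the ideal, so the
    whole space is a countable union of nowhere dense sets. Such sets can be
    added to a piece without harm. So the roots of the trees, respectively any
    infinite family of at most |K| sets of the first sort, extend to a
    partition of the space, the leftover points being distributed according to
    their level. This freedom is what allows all the partitions on one and the
    same space. *)

Set Implicit Arguments.
Unset Strict Implicit.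
Unset Printing Implicit Defensive.

Local Open Scope classical_set_scope.
Local Open Scope card_scope.

(** * Cardinal arithmetic *)

Lemma card_le_funP {T U : Type} (u0 : U) (A : set T) (B : set U) :
  A #<= B <-> exists2 f : T -> U, set_fun A B f & set_inj A f.
Proof.
split; first by move=> /card_leP[f]; apply/injfunPex; squash (valLR u0 f).
by move=> /injfunPex[f]; exact: inj_card_le.
Qed.

Lemma card_leT_inj {T U : Type} :
  [set: T] #<= [set: U] -> exists f : T -> U, injective f.
Proof.
have [u0|noU] := pselect (inhabited U); last first.
  move=> /card_leP[f].
  by exists (fun x => set_val (f (SigSub (mem_set (I : [set: T] x))))) => x;
    case: noU; constructor; exact: set_val (f (SigSub (mem_set (I : [set: T] x)))).
case: u0 => u0 /(card_le_funP u0)[f _ finj]; exists f => x y.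
by apply: finj; rewrite in_setT.
Qed.

Lemma inj_card_leT {T U : Type} (f : T -> U) (A : set U) :
  injective f -> (forall x, A (f x)) -> [set: T] #<= A.
Proof.
move=> finj fA; have [x0|noT] := pselect (inhabited T).
  case: x0 => x0; apply/(card_le_funP (f x0)); exists f => // x y _ _.
  exact: finj.
suff -> : [set: T] = set0 by exact: card_ge0.
by rewrite -subset0 => x _; exact: noT.
Qed.

Lemma chain_common (T : Type) (FF : set (set T)) G1 G2 x y :
  total_on FF subset -> FF G1 -> FF G2 -> G1 x -> G2 y ->
  exists2 G, FF G & G x /\ G y.
Proof.
move=> Ftot F1 F2 Gx Gy; have [/(_ _ Gx) G2x|/(_ _ Gy) G1y] := Ftot _ _ F1 F2.
- by exists G2.
- by exists G1.
Qed.

(** Any maximal partial injection from [A] to [B] exhausts one of the two. *)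
Lemma card_le_total {T U : Type} (A : set T) (B : set U) :
  A #<= B \/ B #<= A.
Proof.
have [a0|/set0P/negP/negPn/eqP->] := pselect (A !=set0); last first.
  by left; exact: card_ge0.
have [b0|/set0P/negP/negPn/eqP->] := pselect (B !=set0); last first.
  by right; exact: card_ge0.
pose pinj (G : set (T * U)) := [/\ G `<=` A `*` B,
  forall a b b', G (a, b) -> G (a, b') -> b = b' &
  forall a a' b, G (a, b) -> G (a', b) -> a = a'].
have [FF FP Ftot|G [[GAB Gfun Ginj] Gmax]] := @Zorn_bigcup _ pinj.
  split.
  - by move=> x [G FG]; case: (FP _ FG) => + _ _; apply.
  - move=> a b b' [G1 F1 Gx] [G2 F2 Gy].
    have [G FG [Ga Gb]] := chain_common Ftot F1 F2 Gx Gy.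
    by case: (FP _ FG) => _ + _; apply; eassumption.
  - move=> a a' b [G1 F1 Gx] [G2 F2 Gy].
    have [G FG [Ga Gb]] := chain_common Ftot F1 F2 Gx Gy.
    by case: (FP _ FG) => _ _; apply; eassumption.
have [domA|/existsNP[a /not_implyP[Aa aG]]] :=
    pselect (forall a, A a -> exists b, G (a, b)).
  left; case: b0 => b0 Bb0; apply/(card_le_funP b0).
  have /choice[f fG] : forall a, exists b, A a -> G (a, b).
    move=> a; have [/domA[b ab]|] := pselect (A a); first by exists b.
    by exists b0.
  exists f => [a /fG /GAB[]//|a a' /set_mem /fG aG /set_mem /fG a'G eqf].
  by apply: Ginj aG _; rewrite eqf.
right; case: a0 => a0 Aa0; apply/(card_le_funP a0).
have ranB b : B b -> exists a', G (a', b).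
  move=> Bb; apply: contrapT => bG.
  have aG' b' : ~ G (a, b') by move=> ?; apply: aG; exists b'.
  have bG' a' : ~ G (a', b) by move=> ?; apply: bG; exists a'.
  apply: (Gmax (G `|` [set (a, b)])).
    split; first by move=> x; left.
    by move=> /(_ (a, b) (or_intror erefl)) /aG'.
  split.
  - by move=> x [/GAB//|->].
  - move=> c d d' [G1|[-> ->]] [G2|[]].
    + exact: Gfun G1 G2.
    + by move=> ca _; move: G1; rewrite ca => /aG'.
    + by move: G2 => /aG'.
    + by move=> ->.
  - move=> c c' d [G1|[-> ->]] [G2|[]].
    + exact: Ginj G1 G2.
    + by move=> _ db; move: G1; rewrite db => /bG'.
    + by move: G2 => /bG'.
    + by move=> ->.
have /choice[f fG] : forall b, exists a, B b -> G (a, b).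
  move=> b; have [/ranB[a' ab]|] := pselect (B b); first by exists a'.
  by exists a0.
exists f => [b /fG /GAB[]//|b b' /set_mem /fG bG /set_mem /fG b'G eqf].
by apply: Gfun bG _; rewrite eqf.
Qed.

Definition pairing (K : Type) (p : K -> K -> K) :=
  forall a b a' b', p a b = p a' b' -> a = a' /\ b = b'.

(** Every infinite cardinal equals its square. The sets [F] used here are total
    injective relations from [A * A] to [A], where the subset [A] of [K], here
    [dom F], is empty or infinite. For a maximal one, either the complement of
    [A] embeds in [A], so that [K] embeds in [A] and inherits a pairing; or [A]
    embeds in its complement, and the relation extends to the union of [A] with
    its copy. *)
Lemma ex_pairing (K : Type) (e : nat -> K) :
  injective e -> exists p : K -> K -> K, pairing p.
Proof.
move=> einj.
pose dom (F : set (K * K * K)) := [set a | exists c, F (a, a, c)].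
pose square (F : set (K * K * K)) := [/\
  forall a b, dom F a -> dom F b -> exists c, F (a, b, c),
  forall a b c, F (a, b, c) -> [/\ dom F a, dom F b & dom F c],
  forall a b a' b' c, F (a, b, c) -> F (a', b', c) -> a = a' /\ b = b' &
  forall z, F z -> exists u : nat -> K, injective u /\ forall n, dom F (u n)].
pose F0 := [set z | exists i j, z = (e i, e j, e (pickle (i, j)))].
have domF0 n : dom F0 (e n) by exists (e (pickle (n, n))); exists n, n.
have inF0 a : dom F0 a -> exists n, a = e n.
  by move=> [c [i [j [-> _ _]]]]; exists i.
have sqF0 : square F0.
  split.
  - move=> _ _ /inF0[i ->] /inF0[j ->].
    by exists (e (pickle (i, j))); exists i, j.
  - by move=> _ _ _ [i [j [-> -> ->]]].
  - move=> _ _ _ _ _ [i [j [-> -> ->]]] [i' [j' [-> -> /einj]]].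
    by move=> /(pcan_inj pickleK)[-> ->].
  - by move=> _ _; exists e.
have [FF FP Ftot|F [Fsq Fmax]] := @Zorn_bigcup _ square.
  have domS G a : FF G -> dom G a -> dom (\bigcup_(X in FF) X) a.
    by move=> FG [c Gc]; exists c; exists G.
  split.
  - move=> a b [c [G1 F1 Gx]] [d [G2 F2 Gy]].
    have [G FG [Ga Gb]] := chain_common Ftot F1 F2 Gx Gy.
    case: (FP _ FG) => /(_ a b) [||r Gr _ _ _]; [by exists c|by exists d|].
    by exists r, G.
  - move=> a b c [G FG Gx]; case: (FP _ FG) => _ /(_ _ _ _ Gx)[Ga Gb Gc] _ _.
    by split; exact: domS FG _.
  - move=> a b a' b' c [G1 F1 Gx] [G2 F2 Gy].
    have [G FG [Ga Gb]] := chain_common Ftot F1 F2 Gx Gy.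
    by case: (FP _ FG) => _ _ + _; apply; eassumption.
  - move=> z [G FG Gz]; case: (FP _ FG) => _ _ _ /(_ _ Gz)[u [uinj uG]].
    by exists u; split=> // n; exact: domS FG _.
case: (Fsq) => Ftotal Fdom Finj Fnat.
pose A := dom F.
have [u [uinj uA]] : exists u : nat -> K, injective u /\ forall n, A (u n).
  have [Fe|/set0P[z /Fnat//]] := eqVneq F set0; exfalso.
  apply: (Fmax F0) => //; rewrite Fe; split; first exact: sub0set.
  by move=> /(_ _ (ex_intro _ 0 (ex_intro _ 0 erefl))).
have /choice[f0 f0F] : forall ab : K * K, exists c,
    A ab.1 -> A ab.2 -> F (ab.1, ab.2, c).
  move=> [a b] /=; have [Aa|] := pselect (A a); last by exists (e 0).
  have [Ab|] := pselect (A b); last by exists (e 0).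
  by have [c] := Ftotal _ _ Aa Ab; exists c.
pose f a b := f0 (a, b).
have fF a b : A a -> A b -> F (a, b, f a b) by exact: (f0F (a, b)).
have fA a b : A a -> A b -> A (f a b).
  by move=> Aa Ab; case: (Fdom _ _ _ (fF _ _ Aa Ab)).
have finj a b a' b' : A a -> A b -> A a' -> A b' ->
    f a b = f a' b' -> a = a' /\ b = b'.
  move=> Aa Ab Aa' Ab' eqf; apply: Finj (fF _ _ Aa Ab) _.
  by rewrite eqf; exact: fF.
(* [u 0] and [u 1] mark whether a point comes from [A] or from outside. *)
have [|] := card_le_total (~` A) A; move=> /(card_le_funP (e 0))[g gS ginj].
  pose m x := if `[< A x >] then f x (u 0) else f (g x) (u 1).
  have mA x : A (m x).
    rewrite /m; case: asboolP => Ax; apply: fA => //; exact: gS.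
  have minj x y : m x = m y -> x = y.
    rewrite /m; case: asboolP => Ax; case: asboolP => Ay.
    - by move=> /finj[].
    - by move=> /finj[||||_ /uinj//] //; exact: gS.
    - by move=> /finj[||||_ /uinj//] //; exact: gS.
    - move=> /finj[||||+ _] //; try exact: gS.
      by apply: ginj; rewrite inE.
  exists (fun x y => f (m x) (m y)) => a b a' b' /finj[]//.
  by move=> /minj -> /minj ->.
exfalso.
have gA a : A a -> ~ A (g a) by move=> /gS.
(* [s true] maps [A] onto its copy; [u] of a number below 4 records which of the
   two halves each argument of the extended pairing comes from, and [g] sends
   the new values into the copy. *)
pose s (i : bool) a := if i then g a else a.
pose new := [set z | exists a b i j,
  [/\ A a, A b, i || j & z = (s i a, s j b, g (f (f a b) (u (i + j.*2)%N)))]].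
have newA a b i j : A a -> A b -> A (f (f a b) (u (i + j.*2)%N)).
  by move=> Aa Ab; apply: (fA) => //; exact: fA.
have domU a : dom (F `|` new) a -> exists2 b, A b & exists i, a = s i b.
  case=> c [Fc|[b [b' [i [j [Ab _ _ [-> _ _]]]]]]].
    by exists a; [exists c|exists false].
  by exists b => //; exists i.
have Udom i b : A b -> dom (F `|` new) (s i b).
  case: i => [] Ab; last by case: Ab => c Fc; exists c; left.
  exists (g (f (f b b) (u (true + true.*2)%N))); right.
  by exists b, b, true, true.
apply: (Fmax (F `|` new)).
  split; first by move=> x; left.
  have Au := uA 0.
  have newu : new (g (u 0), g (u 0), g (f (f (u 0) (u 0)) (u 3))).
    by exists (u 0), (u 0), true, true.
  by move=> /(_ _ (or_intror newu))/Fdom[/(gA _ Au)].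
split.
- move=> _ _ /domU[a Aa [i ->]] /domU[b Ab [j ->]].
  have [ij|/norP[/negPf-> /negPf->]] := boolP (i || j); last first.
    by exists (f a b); left; exact: fF.
  exists (g (f (f a b) (u (i + j.*2)%N))); right.
  by exists a, b, i, j.
- move=> a b c [/Fdom[Aa Ab Ac]|[a' [b' [i [j [Aa Ab ij [-> -> ->]]]]]]].
    by split; [exact: (Udom false)|exact: (Udom false)|exact: (Udom false)].
  by split; [exact: Udom|exact: Udom|apply: (Udom true); exact: newA].
- move=> a b a' b' c [F1|[a1 [b1 [i1 [j1 [Aa1 Ab1 ij1 [-> -> ->]]]]]]]
    [F2|[a2 [b2 [i2 [j2 [Aa2 Ab2 ij2 [-> -> ]]]]]]].
  + exact: Finj F1 F2.
  + move=> cg; case: (Fdom _ _ _ F1) => _ _ Ac.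
    by case: (gA _ (newA _ _ i2 j2 Aa2 Ab2)); rewrite -cg.
  + by case: (Fdom _ _ _ F2) => _ _ Ac; case: (gA _ (newA _ _ i1 j1 Aa1 Ab1)).
  + move=> /ginj; rewrite !inE =>
      /(_ (newA _ _ _ _ Aa1 Ab1) (newA _ _ _ _ Aa2 Ab2)).
    move=> /finj[||||/finj[||||<- <-]] //; try exact: fA.
    move=> /uinj; clear -ij1 ij2.
    by case: i1 j1 i2 j2 ij1 ij2 => [] [] [] [].
- move=> z _; exists u; split=> // n; exact: (Udom false).
Qed.

Lemma ex_seq_code (K : Type) (e : nat -> K) (p : K -> K -> K) :
  injective e -> pairing p -> exists q : seq K -> K, injective q.
Proof.
move=> einj pP.
exists (fun l => p (e (size l)) (foldr p (e 0) l)).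
move=> l l' /pP[/einj].
elim: l l' => [|x l IH] [|y l'] //= [eqs] /pP[-> eqf].
by rewrite (IH l').
Qed.

(** Index an injection of [K] by pairs. If some row goes into [A], this row is a
    copy of [K]; otherwise every row has a point sent to [B]. *)
Lemma card_le_setU (K : Type) (p : K -> K -> K) T (A B : set T) :
  pairing p -> [set: K] #<= A `|` B -> [set: K] #<= A \/ [set: K] #<= B.
Proof.
move=> pP KAB; have [[k0]|noK] := pselect (inhabited K); last first.
  left; suff -> : [set: K] = set0 by exact: card_ge0.
  by rewrite -subset0 => x _; exact: noK.
have [t0|/set0P/negP/negPn/eqP AB0] := pselect ((A `|` B) !=set0); last first.
  by move: KAB; rewrite AB0 card_le0 => /eqP K0; have : set0 k0 by rewrite -K0.
case: t0 => t0 _; move: KAB => /(card_le_funP t0)[f fAB finj].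
have [[a aA]|noA] := pselect (exists a, forall b, A (f (p a b))).
  left; apply: (@inj_card_leT _ _ (fun b => f (p a b))) => // x y /finj.
  by rewrite !in_setT => /(_ isT isT)/pP[].
have /choice[g gA] : forall a, exists b, ~ A (f (p a b)).
  by move=> a; apply/existsNP => aA; apply: noA; exists a.
right; apply: (@inj_card_leT _ _ (fun a => f (p a (g a)))).
  by move=> x y /finj; rewrite !in_setT => /(_ isT isT)/pP[].
by move=> a; have [/gA//|] : (A `|` B) (f (p a (g a))) by exact: fAB.
Qed.

(** * Forcing a maximal ideal to be nowhere dense *)

Definition ideal (S : Type) (N : set (set S)) :=
  (forall A B, A `<=` B -> N B -> N A) /\
  (forall A B, N A -> N B -> N (A `|` B)).

(** The trace on [S] of the basic open set of the cube [I -> bool] consisting of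
    the points that agree with [f] on [F]; taking [f] total makes every box
    consistent, so that independence of [c] says that no box is empty. *)
Definition box (S : Type) (I : eqType) (c : I -> S -> bool) (F : seq I)
  (f : I -> bool) : set S := [set x | forall i, i \in F -> c i x = f i].

Definition codense (S : Type) (I : eqType) (J : Type) (c : I -> S -> bool)
    (D : J -> set S) (N : set (set S)) :=
  forall F f j A, N A -> exists x, [/\ box c F f x, D j x & ~ A x].

(** What the construction provides. In the topology with the boxes of [c] as a
    basis, [forced_codense] says that the sets [D j] are dense, even after
    removal of a set of [N]; [forced_trap] that a set outside [N] is somewhere
    dense and contains, up to [N], a box intersected with some [D j];
    [forced_sep] that the sets of [N] are closed and discrete. *)
Record forced (S : Type) (I : eqType) (J : Type) (D : J -> set S)
    (N : set (set S)) (c : I -> S -> bool) : Prop := Forced {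
  forced_ideal : ideal N;
  forced_point : forall x, N [set x];
  forced_codense : codense c D N;
  forced_trap : forall A, ~ N A ->
    exists F f j B, N B /\ box c F f `&` D j `<=` A `|` B;
  forced_sep : forall A B, N A -> N B ->
    exists i, B `<=` [set x | c i x] /\ forall x, A x -> ~ B x -> ~~ c i x }.

(** [N] is a maximal ideal containing [N0] for which the sets [D j] are codense
    with respect to [b]; maximality gives the trap property for [b]. The
    partition [b i] is altered on the two sets coded by [i], when both are in
    [N]; all partitions change only modulo [N], so codensity and the trap
    property pass from [b] to [c]. *)
Lemma ex_forced (S : Type) (I : eqType) (J : Type) (D : J -> set S)
    (b : I -> S -> bool) (code : I -> set S * set S) (N0 : set (set S)) :
  ideal N0 -> N0 set0 -> (forall x, N0 [set x]) -> codense b D N0 ->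
  (forall AB, exists i, code i = AB) ->
  exists N (c : I -> S -> bool), N0 `<=` N /\ forced D N c.
Proof.
move=> N0ideal N00 N01 N0cod codeS.
(* The empty family is admitted because it is the union of the empty chain. *)
pose ok (N : set (set S)) := N = set0 \/ [/\ N0 `<=` N, ideal N & codense b D N].
have [FF FP Ftot|N [[N_eq0|[N0N Nideal Ncod]] Nmax]] := @Zorn_bigcup _ ok.
- have [F0|nF0] := pselect (forall N, FF N -> N = set0).
    left; rewrite -subset0 => A [N FN NA]; by rewrite -(F0 _ FN).
  right; have [N FN NP] : exists2 N, FF N & [/\ N0 `<=` N, ideal N & codense b D N].
    move/existsNP: nF0 => [N /not_implyP[FN N0']].
    by exists N => //; have [] := FP _ FN.
  split.
  + by case: NP => N0N _ _ A /N0N NA; exists N.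
  + split=> [A B AB [N1 F1 N1B]|A B [N1 F1 N1A] [N2 F2 N2B]].
      exists N1 => //; have [N1e|[_ [sub _] _]] := FP _ F1.
        by move: N1B; rewrite N1e.
      exact: sub AB _.
    have [N3 F3 [N3A N3B]] := chain_common Ftot F1 F2 N1A N2B.
    exists N3 => //; have [N3e|[_ [_ cup] _]] := FP _ F3.
      by move: N3A; rewrite N3e.
    exact: cup.
  + move=> F f j A [N1 F1 N1A]; have [N1e|[_ _]] := FP _ F1.
      by move: N1A; rewrite N1e.
    exact.
- exfalso; apply: (Nmax N0); last by right; split.
  by rewrite N_eq0; split; [exact: sub0set|move=> /(_ _ N00)].
have [Nsub NU] := Nideal.
have trap A : ~ N A -> exists F f j B, N B /\ box b F f `&` D j `<=` A `|` B.
  move=> NA; apply: contrapT => notrap.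
  (* otherwise the ideal generated by [N] and [A] would still be admissible *)
  pose N' := [set X | exists2 B, N B & X `<=` A `|` B].
  have NN' : N `<=` N' by move=> B NB; exists B => //; right.
  apply: (Nmax N').
    by split=> // /(_ A) N'N; apply: NA; apply: N'N; exists set0; [exact: N0N|left].
  right; split.
  - exact: subset_trans NN'.
  - split=> [X Y XY [B NB YB]|X Y [B NB XB] [C NC YC]].
      by exists B => //; exact: subset_trans YB.
    exists (B `|` C); first exact: NU.
    by move=> x [/XB[]|/YC[]]; [left|right; left|left|right; right].
  - move=> F f j X [B NB XB]; apply: contrapT => noX; apply: notrap.
    exists F, f, j, B; split=> // x [xF xj]; apply: XB.
    by apply: contrapT => Xx; apply: noX; exists x.
pose c i x := let AB := code i in
  if `[< N AB.1 /\ N AB.2 >] then `[< AB.2 x \/ (b i x /\ ~ AB.1 x) >] else b i x.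
have c_b i : exists2 E, N E & forall x, ~ E x -> c i x = b i x.
  rewrite /c; case: asboolP => [[N1 N2]|_]; last by exists set0; first exact: N0N.
  exists ((code i).1 `|` (code i).2); first exact: NU.
  move=> x /not_orP[nA nB]; apply/asboolP/idP => [[//|[//]]|bix].
  by right.
have box_bc (F : seq I) :
    exists2 E, N E & forall x, ~ E x -> {in F, forall i, c i x = b i x}.
  elim: F => [|i F [E NE EF]]; first by exists set0; first exact: N0N.
  have [E' NE' E'i] := c_b i; exists (E' `|` E); first exact: NU.
  move=> x /not_orP[nE' nE] k; rewrite inE => /orP[/eqP->|]; first exact: E'i.
  exact: EF.
exists N, c; split=> //; split=> //.
- by move=> x; exact: N0N.
- move=> F f j A NA; have [E NE EF] := box_bc F.
  have [x [xF xj /not_orP[nA nE]]] := Ncod F f j _ (NU _ _ NA NE).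
  by exists x; split=> // i iF; rewrite EF// xF.
- move=> A /trap[F [f [j [B [NB FB]]]]]; have [E NE EF] := box_bc F.
  exists F, f, j, (B `|` E); split; first exact: NU.
  move=> x [xF xj]; have [Ex|nEx] := pselect (E x); first by right; right.
  have [|Ax|Bx] := FB x; [|by left|by right; left].
  by split=> // i iF; rewrite -EF// xF.
- move=> A B NA NB; have [i iAB] := codeS (A, B); exists i.
  rewrite /c iAB /=; case: asboolP => [_|[]//]; split=> [x Bx|x Ax nBx].
    by apply/asboolP; left.
  by apply/asboolPn => -[|[]].
Qed.

(** * Topology generated by the altered partitions *)

Lemma cube_box (I : eqType) (F : seq I) (f : I -> bool) :
  open [set g : cantor_cube I | forall i, i \in F -> g i = f i].
Proof.
elim: F => [|i F IH].
  suff -> : [set g : cantor_cube I | forall i, i \in [::] -> g i = f i] = setT.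
    exact: openT.
  by apply/seteqP; split.
suff -> : [set g : cantor_cube I | forall k, k \in i :: F -> g k = f k] =
    (fun g : cantor_cube I => g i) @^-1` [set f i] `&`
    [set g : cantor_cube I | forall k, k \in F -> g k = f k].
  apply: openI => //.
  have ci : continuous (fun g : cantor_cube I => g i).
    exact: (@proj_continuous I (fun=> bool) i).
  by move/continuousP: ci; apply; exact: discrete_open.
apply/seteqP; split=> [g gF|g [gi gF] k].
  by split=> [|k kF]; apply: gF; rewrite inE ?eqxx// kF orbT.
by rewrite inE => /orP[/eqP->|/gF].
Qed.

(** The finite-support neighbourhoods form a filter, which converges to [g] in
    the product topology because it does so in each coordinate. *)
Lemma cube_nbhs (I : eqType) (O : set (cantor_cube I)) g : open O -> O g ->
  exists F : seq I, [set h | forall i, i \in F -> h i = g i] `<=` O.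
Proof.
move=> oO Og.
pose U (F : seq I) := [set h : cantor_cube I | forall i, i \in F -> h i = g i].
have UF : Filter (filter_from setT U).
  apply: filter_from_filter; first by exists [::].
  move=> F G _ _; exists (F ++ G) => // h hFG.
  by split=> i iF; apply: hFG; rewrite mem_cat iF ?orbT.
suff /(_ O) : filter_from setT U --> g.
  case; first by apply: open_nbhs_nbhs.
  by move=> F _ FO; exists F.
apply/cvg_sup => i A.
move=> [_ [[V oV <-] Vg] BA].
exists [:: i] => // h hi; apply: BA => /=.
by rewrite hi// inE.
Qed.

(** [h] identifies [Y] with a subspace of [S] under the topology of boxes. All
    the spaces of the theorem, down to subspaces of subspaces, are handled
    through such maps, so that everything takes place in the fixed set [S]. *)
Record box_embedding (S : Type) (I : eqType) (c : I -> S -> bool)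
    (Y : topologicalType) (h : Y -> S) : Prop := BoxEmbedding {
  be_inj : injective h;
  be_open : forall F f, open (h @^-1` box c F f);
  be_nbhs : forall (O : set Y) y, open O -> O y ->
    exists F, h @^-1` box c F (c^~ (h y)) `<=` O }.

Lemma box_embedding_sub S (I : eqType) (c : I -> S -> bool)
    (Y : topologicalType) (h : Y -> S) (A : set Y) :
  box_embedding c h -> box_embedding c (fun y : A => h (set_val y)).
Proof.
case=> hinj hopen hnbhs; split.
- by move=> x y /hinj; rewrite !set_valE; exact: val_inj.
- by move=> F f; exists (h @^-1` box c F f) => //; exact: hopen.
- move=> O y [O' oO' <-] O'y; have [F FO'] := hnbhs _ _ oO' O'y.
  by exists F => z; exact: FO'.
Qed.

Lemma box_cat S (I : eqType) (c : I -> S -> bool) F G f :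
  box c (F ++ G) f = box c F f `&` box c G f.
Proof.
apply/seteqP; split=> [x xFG|x [xF xG] i].
  by split=> i ?; apply: xFG; rewrite mem_cat; apply/orP; [left|right].
by rewrite mem_cat => /orP[/xF|/xG].
Qed.

Lemma box_ext S (I : eqType) (c : I -> S -> bool) F f x :
  box c F f x -> box c F (c^~ x) = box c F f.
Proof.
by move=> xF; apply/seteqP; split=> y yF i iF; have := yF i iF; rewrite -?xF.
Qed.

Section Forced.
Variables (S : Type) (I : eqType) (J : Type) (D : J -> set S).
Variables (N : set (set S)) (c : I -> S -> bool).
Hypothesis DNc : forced D N c.
Let NU := (forced_ideal DNc).2.

Section Embedding.
Variables (Y : topologicalType) (h : Y -> S).
Hypothesis he : box_embedding c h.

(** A point [h y] outside [A] and the set [A] are separated by one partition. *)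
Lemma ideal_closed A : N A -> closed (h @^-1` A).
Proof.
move=> NA y yA; apply: contrapT => nAy.
have [i [/(_ _ erefl) iy iA]] := forced_sep DNc NA (forced_point DNc (h y)).
have /yA[z [Az]] : nbhs y (h @^-1` box c [:: i] xpredT).
  apply: open_nbhs_nbhs; split; first exact: be_open.
  by move=> k; rewrite inE => /eqP->.
move=> /(_ i (mem_head _ _)); apply/negP/iA => // hz.
by apply: nAy; rewrite /= -hz.
Qed.

(** Each [D j] meets every box outside [B]. *)
Lemma dense_from j A B : N B -> D j `<=` h @` A `|` B -> dense A.
Proof.
move=> NB DAB O [y Oy] oO; have [F FO] := be_nbhs he oO Oy.
have [x [xF /DAB[[z Az hz]|//] nBx]] := forced_codense DNc F (c^~ (h y)) j NB.
by exists z; split=> //; apply: FO; rewrite /= hz.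
Qed.

(** Each set of [N] is discrete, as its points can be separated from the rest of
    it; an open one would consist of isolated points. *)
Lemma crowded_open_notin_ideal O : crowded Y -> open O -> O !=set0 -> ~ N (h @` O).
Proof.
move=> Ycr oO [y Oy] NO.
have [i [/(_ _ erefl) iy iO]] := forced_sep DNc NO (forced_point DNc (h y)).
suff : isolated [set: Y] y by rewrite Ycr.
split; first by rewrite inE.
exists (O `&` h @^-1` box c [:: i] xpredT).
  apply: open_nbhs_nbhs; split; first by apply: openI => //; exact: be_open.
  by split=> // k; rewrite inE => /eqP->.
rewrite setIT; apply/seteqP; split=> [z [Oz zi]|_ ->].
  apply: contrapT => zy; have := zi i (mem_head _ _); apply/negP/iO.
    by exists z.
  by move=> /(be_inj he).
by split=> // k; rewrite inE => /eqP->.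
Qed.

(** A set outside [N] traps a box intersected with a dense set, and is therefore
    dense in this box. A set in [N] is closed and contains no box. *)
Lemma nowhere_denseP (j0 : J) (hsurj : set_surj setT setT h) A :
  nowhere_dense A <-> N (h @` A).
Proof.
have hS x : exists y, h y = x.
  by have [y _ <-] := hsurj x Logic.I; exists y.
split=> [Anwd|NA].
  apply: contrapT => /(forced_trap DNc)[F [f [j [B [NB FB]]]]].
  have [x0 [x0F _ _]] := forced_codense DNc F f j NB.
  have [y yx0] := hS x0; rewrite -yx0 in x0F.
  suff : (closure A)^° y by rewrite Anwd.
  apply: (@filterS _ _ _ (h @^-1` box c F f)); last first.
    by apply: open_nbhs_nbhs; split=> //; exact: be_open.
  move=> z zF V; rewrite nbhsE => -[V' [oV' V'z] V'V].
  have [F' F'V'] := be_nbhs he oV' V'z.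
  have [x []] := forced_codense DNc (F ++ F') (c^~ (h z)) j NB.
  rewrite box_cat => -[] /[1!(box_ext zF)] xF xF' xj nBx.
  have [[t At tx]|//] := FB x (conj xF xj).
  by exists t; split=> //; apply: V'V; apply: F'V'; rewrite /= tx.
have clA : closed A.
  suff -> : A = h @^-1` (h @` A) by exact: ideal_closed.
  by apply/seteqP; split=> [y Ay|y [z Az /(be_inj he) <-]] //; exists y.
rewrite /nowhere_dense -subset0 => y.
move=> /(be_nbhs he (@open_interior _ _))[F FA].
have [x [xF xj nAx]] := forced_codense DNc F (c^~ (h y)) j0 NA.
apply: nAx; have [z zx] := hS x; exists z => //.
by apply: clA; apply: interior_subset; apply: FA; rewrite /= zx.
Qed.

(** Take a maximal partial colouring [G] of [Y] by [K] in which every open set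
    meeting one colour meets all of them. If some open set [O] had no coloured
    point, it would contain, up to [N], a box intersected with some [D j'],
    and the sets [D (E k)] inside [D j'], being dense in this box, would be
    colours extending [G]. So the coloured points are dense, and then so is
    each colour. The condition on [D j] ensures that the set [D j'] that shows
    up is one that splits. *)
Lemma resolvable_of_split (K : Type) j : N (range h `\` D j) ->
    crowded Y ->
    (forall j' x, D j x -> D j' x -> exists E : K -> J,
       (forall k, D (E k) `<=` D j') /\ trivIset setT (D \o E)) ->
  resolvable Y K.
Proof.
move=> thin Ycr splitD.
pose ok (G : set (Y * K)) :=
  (forall y k k', G (y, k) -> G (y, k') -> k = k') /\
  (forall O k k', open O -> (exists2 y, O y & G (y, k)) ->
     exists2 y, O y & G (y, k')).
have [FF FP Ftot|G [[Gfun Gmix] Gmax]] := @Zorn_bigcup _ ok.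
  split.
    move=> y k k' [G1 F1 Gx] [G2 F2 Gy].
    have [G FG [Ga Gb]] := chain_common Ftot F1 F2 Gx Gy.
    exact: (FP _ FG).1 Ga Gb.
  move=> O k k' oO [y Oy [G FG Gy]].
  have [|z Oz Gz] := (FP _ FG).2 O k k' oO; first by exists y.
  by exists z => //; exists G.
exists (fun k => [set y | G (y, k)]); split; last first.
  by move=> k k' _ _ [y [/Gfun]]; exact.
move=> k O [y Oy] oO; apply: contrapT => Ok.
have Ocol z k' : O z -> ~ G (z, k').
  move=> Oz Gz; apply: Ok; have [|t Ot Gt] := Gmix O k' k oO; first by exists z.
  by exists t.
have /(forced_trap DNc)[F [f [j' [B [NB FB]]]]] : ~ N (h @` O).
  by apply: crowded_open_notin_ideal => //; exists y.
have [E [ED Etriv]] : exists E : K -> J,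
    (forall k, D (E k) `<=` D j') /\ trivIset setT (D \o E).
  have [x [xF xj' /not_orP[nBx nx]]] := forced_codense DNc F f j' (NU NB thin).
  apply: (splitD _ _ _ xj'); apply: contrapT => nxj; apply: nx; split=> //.
  by have [[z _ <-]|//] := FB x (conj xF xj'); exists z.
pose new := [set zk : Y * K | [/\ O zk.1, box c F f (h zk.1), D (E zk.2) (h zk.1)
                             & ~ B (h zk.1)]].
have exnew F' z k' : box c F f (h z) ->
    exists2 t, box c F' (c^~ (h z)) (h t) & new (t, k').
  move=> zF; have [x []] := forced_codense DNc (F ++ F') (c^~ (h z)) (E k') NB.
  rewrite box_cat => -[] /[1!(box_ext zF)] xF xF' xE nBx.
  have [[t Ot tx]|//] := FB x (conj xF (ED _ _ xE)).
  by exists t; rewrite ?tx//; split=> /=; rewrite ?tx.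
have [z [Oz zF]] : exists z, O z /\ box c F f (h z).
  have [x [xF xE nBx]] := forced_codense DNc F f (E k) NB.
  have [[t Ot tx]|//] := FB x (conj xF (ED _ _ xE)).
  by exists t; rewrite tx.
apply: (Gmax (G `|` new)).
  split; first by move=> t; left.
  have [t _ tk] := exnew [::] z k zF.
  by move=> /(_ _ (or_intror tk)); apply: Ocol; case: tk.
split.
  move=> t k1 k2 [G1|[O1 _ E1 _]] [G2|[O2 _ E2 _]].
  - exact: Gfun G1 G2.
  - by case: (Ocol _ _ O2 G1).
  - by case: (Ocol _ _ O1 G2).
  - by apply: Etriv => //; exists (h t).
move=> O' k1 k2 oO' [t O't [Gt|[Ot tF tE nBt]]].
  have [|s O's Gs] := Gmix O' k1 k2 oO'; first by exists t.
  by exists s => //; left.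
have [F' F'O'] := be_nbhs he oO' O't.
have [s sF' snew] := exnew F' t k2 tF.
by exists s; [exact: F'O'|right].
Qed.

(** If [A] is dense, its complement is in [N], hence closed: otherwise this
    complement would contain a box intersected with [D j], up to [N], and [A]
    would miss the points of [D j] in this box, again up to [N]. As the rest of
    [Y] is in [N] and sets of [N] are closed, there would remain a nonempty
    open set missing [A]. *)
Lemma submaximal_of_single j : N (range h `\` D j) ->
  (forall j' x, D j x -> D j' x -> j' = j) -> submaximal Y.
Proof.
move=> thin Dj A Adense.
have NAC : N (range h `\` h @` A).
  apply: contrapT => /(forced_trap DNc)[F [f [j' [B [NB FB]]]]].
  have ND := NU NB thin.
  have [x [xF xj' nx]] := forced_codense DNc F f j' ND.
  have [[[y _ yx] _]|Bx] := FB x (conj xF xj'); last by apply: nx; left.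
  have xj : D j x.
    apply: contrapT => nxj; apply: nx; right; split=> //.
    by exists y.
  have jj' : j' = j by exact: Dj xj xj'.
  have [||z [[zF zB] Az]] :=
      Adense (h @^-1` box c F f `\` h @^-1` (B `|` (range h `\` D j))).
  - by exists y; split; rewrite /= yx.
  - by apply: openI; [exact: be_open|apply: closed_openC; exact: ideal_closed].
  have zj : D j (h z).
    by apply: contrapT => nzj; apply: zB; right; split=> //; exists z.
  have [|[_ []]|Bz] := FB (h z).
  - by split=> //; rewrite jj'.
  - by exists z.
  - by apply: zB; left.
have -> : A = ~` (h @^-1` (range h `\` h @` A)).
  apply/seteqP; split=> [y Ay [_]|y nyA].
    by apply; exists y.
  apply: contrapT => nAy; apply: nyA; split; first by exists y.
  by move=> [z Az /(be_inj he) zy]; apply: nAy; rewrite -zy.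
by apply: closed_openC; exact: ideal_closed.
Qed.

End Embedding.
End Forced.

(** If [E true] and [E false] are disjoint dense subsets of [A], adding to each of
    them the complement of the closure of [A] makes it dense in [T], hence open;
    so each of the two is open in [A], and the first meets the second. *)
Lemma submaximal_hered_irresolvable (T : topologicalType) :
  submaximal T -> hereditarily_irresolvable T.
Proof.
move=> Tsub A [a0 Aa0] [E [Edense Etriv]].
have Wopen b : open (set_val @` E b `|` ~` closure A).
  apply: Tsub => O [y Oy] oO.
  have [[z [Oz Az]]|OA] := pselect ((O `&` A) !=set0).
    have [||t [Ot Et]] := Edense b (set_val @^-1` O).
    - by exists (SigSub (mem_set Az)).
    - by exists O.
    by exists (set_val t); split=> //; left; exists t.
  exists y; split=> //; right => /(_ O)[|t [At Ot]].
    by apply: open_nbhs_nbhs.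
  by apply: OA; exists t.
have [t [_ Et]] : ([set: A] `&` E true) !=set0.
  by apply: (Edense true setT); [exists (SigSub (mem_set Aa0))|exact: openT].
have [||z [zW Ez]] := Edense false (set_val @^-1` (set_val @` E true `|` ~` closure A)).
- by exists t; left; exists t.
- by exists (set_val @` E true `|` ~` closure A).
case: zW => [[s Es sz]|[]]; last by apply: subset_closure; exact: set_valP.
have {}sz : s = z by apply: val_inj; rewrite -!set_valE.
suff : true = false by [].
by apply: Etriv => //; exists z; split=> //; rewrite -sz.
Qed.

(** * The underlying set, the independent family and the dense pieces *)

(** [word] and [code] carry the independent family; [kind], [tail] and [level]
    are used to cut out the sets [piece j] and to write the space as a countable
    union of nowhere dense sets. *)
Record point (K : Type) := Point {
  word : seq K;
  code : seq (seq bool);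
  level : nat;
  kind : K + nat;
  tail : seq K }.

Lemma card_point (K : Type) : infinite_set [set: K] ->
  [set: point K] #= [set: K].
Proof.
move=> /infiniteP/card_leT_inj[e einj]; have [p pP] := ex_pairing einj.
have [q qinj] := ex_seq_code einj pP.
apply/card_eqPle; split; last first.
  by apply: (@inj_card_leT _ _ (fun k => Point [::] [::] 0 (inl k) [::])) => // x y [].
pose kcode (j : K + nat) := match j with
  inl k => p (e 0) k | inr n => p (e 1) (e n) end.
have kinj : injective kcode.
  by move=> [k|n] [k'|n'] /= /pP[/einj// _]; [move=> ->|move=> /einj->].
apply: (@inj_card_leT _ _ (fun x => p (p (q (word x)) (e (pickle (code x))))
  (p (p (e (level x)) (kcode (kind x))) (q (tail x))))) => //.
move=> [w c l k t] [w' c' l' k' t'] /= /pP[/pP[/qinj-> /einj]].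
move=> /(pcan_inj pickleK)-> /pP[/pP[/einj-> /kinj->] /qinj->] //.
Qed.

Definition trace (K : Type) (w : seq K) (X : set K) := [seq `[< X k >] | k <- w].

(** The independent family of Fichtenholz and Kantorovich: [x] holds a finite
    list of elements of [K] and a finite set of admissible traces on it. *)
Definition membership (K : Type) (X : set K) (x : point K) : bool :=
  trace (word x) X \in code x.

(** Concatenate lists that contain, for each two members of [F], an element of
    their symmetric difference. *)
Lemma trace_inj (K : Type) (F : seq (set K)) :
  exists w : seq K, {in F &, injective (trace w)}.
Proof.
have trace_cat w w' X Y : trace (w ++ w') X = trace (w ++ w') Y ->
    trace w X = trace w Y /\ trace w' X = trace w' Y.
  rewrite /trace !map_cat => /eqP.
  by rewrite eqseq_cat ?size_map// => /andP[/eqP? /eqP].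
have separate X (G : seq (set K)) :
    exists w, forall Y, Y \in G -> trace w X = trace w Y -> X = Y.
  elim: G => [|Y G [w wG]]; first by exists [::].
  have [XY|XY] := pselect (X = Y).
    by exists w => Z; rewrite inE => /orP[/eqP->//|/wG].
  have [k Xk] : exists k, `[< X k >] <> `[< Y k >].
    apply/existsNP => eqXY; apply: XY; apply/funext => k.
    have eqk := eqXY k.
    by apply/propext; split=> /asboolP; [rewrite eqk|rewrite -eqk] => /asboolP.
  exists (k :: w) => Z; rewrite inE => /orP[/eqP->|/wG GZ] [].
    by move=> /Xk.
  by move=> _ /GZ.
elim: F => [|X F [w wF]]; first by exists [::].
have [w' w'X] := separate X F.
exists (w ++ w') => Y Z; rewrite !inE.
move=> /orP[/eqP->|YF] /orP[/eqP->|ZF] /trace_cat[eqw eqw'] //.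
- exact: w'X.
- by apply/esym/w'X.
- exact: wF.
Qed.

Lemma membership_independent (K : Type) (F : seq (set K)) (f : set K -> bool) :
  exists w c, forall l j t, box (@membership K) F f (Point w c l j t).
Proof.
have [w winj] := trace_inj F.
exists w, [seq trace w X | X <- F & f X] => l j t X XF.
rewrite /membership /=; apply/mapP/idP => [[Y]|fX].
  by rewrite mem_filter => /andP[fY YF] /winj ->.
by exists X; rewrite // mem_filter fX.
Qed.

(** A single set for [inl k]; for [inr (n, s)] a node of a tree, which contains
    the disjoint nodes [inr (n, s ++ [:: k])]. *)
Definition piece (K : Type) (j : K + nat * seq K) : set (point K) :=
  match j with
  | inl k => [set x | kind x = inl k]
  | inr (n, s) => [set x | kind x = inr n /\ exists t, tail x = s ++ t]
  end.

(** The ideal generated by the sets of cardinality less than |K| and the sets of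
    bounded level. *)
Definition thin (K : Type) (A : set (point K)) :=
  exists n, ~ ([set: K] #<= A `&` [set x | n <= level x]%N).

Lemma thin_ideal (K : Type) : infinite_set [set: K] -> ideal (@thin K).
Proof.
move=> /infiniteP/card_leT_inj[e einj]; have [p pP] := ex_pairing einj.
split=> [A B AB [n Bn]|A B [n An] [m Bm]].
  exists n => /card_le_trans KA; apply: Bn; apply: KA; apply: subset_card_le.
  exact: setSI.
exists (maxn n m); rewrite setIUl => /(card_le_setU pP)[] /card_le_trans KA.
- apply: An; apply: KA; apply: subset_card_le; apply: setIS => x /=.
  by rewrite geq_max => /andP[].
- apply: Bm; apply: KA; apply: subset_card_le; apply: setIS => x /=.
  by rewrite geq_max => /andP[].
Qed.

Lemma small_thin (K : Type) (A : set (point K)) : ~ ([set: K] #<= A) -> thin A.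
Proof.
move=> KA; exists 0 => /card_le_trans KA'; apply: KA; apply: KA'.
by apply: subset_card_le => x [].
Qed.

Lemma finite_thin (K : Type) (A : set (point K)) : infinite_set [set: K] ->
  finite_set A -> thin A.
Proof. by move=> Kinf Afin; apply: small_thin => /card_le_finite/(_ Afin). Qed.

Lemma level_thin (K : Type) n : infinite_set [set: K] ->
  thin [set x : point K | level x = n].
Proof.
move=> Kinf; exists n.+1 => /card_le_finite; rewrite (_ : _ `&` _ = set0) => [fin|].
  by apply: Kinf; apply: fin; exact: finite_set0.
by rewrite -subset0 => x [/= ->]; rewrite ltnn.
Qed.

(** With [word] and [code] chosen to lie in the box, and [kind] and [level]
    prescribed, the [tail] is still free to range over |K| values. *)
Lemma codense_membership (K : Type) : codense (@membership K) (@piece K) (@thin K).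
Proof.
move=> F f j A [n An]; apply: contrapT => nox; apply: An.
have [w [c wc]] := membership_independent F f.
pose g k := match j with
  | inl i => Point w c n (inl i) [:: k]
  | inr (m, s) => Point w c n (inr m) (s ++ [:: k])
  end.
have gpiece k : piece j (g k).
  by rewrite /g; case: (j) => [i|[m s]] //=; split=> //; exists [:: k].
have glevel k : level (g k) = n by rewrite /g; case: (j) => [i|[m s]].
apply: (@inj_card_leT _ _ g).
  rewrite /g => k k'; case: (j) => [i|[m s]] [] //.
  by move=> /(congr1 (drop (size s))); rewrite !drop_size_cat// => -[].
move=> k; split; last by rewrite /= glevel.
apply: contrapT => nA; apply: nox; exists (g k); split=> //.
by rewrite /g; case: (j) => [i|[m s]]; exact: wc.
Qed.

(** [K] contains two disjoint copies of itself, hence of [S], so that one subset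
    of [K] can store two subsets of [S]. *)
Lemma ex_set_code (K S : Type) : infinite_set [set: K] -> [set: S] #<= [set: K] ->
  exists g : set K -> set S * set S, forall AB, exists X, g X = AB.
Proof.
move=> /infiniteP/card_leT_inj[e einj] /card_leT_inj[i iinj].
have [p pP] := ex_pairing einj.
exists (fun X => ([set x | X (p (e 0) (i x))], [set x | X (p (e 1) (i x))])).
move=> [A B]; exists [set k | (exists2 x, A x & k = p (e 0) (i x)) \/
                        (exists2 x, B x & k = p (e 1) (i x))].
congr pair; apply/seteqP; split=> x /=.
- by move=> [[y Ay /pP[_ /iinj->]]|[y _ /pP[/einj]]].
- by move=> Ax; left; exists x.
- by move=> [[y _ /pP[/einj]]|[y Ay /pP[_ /iinj->]]].
- by move=> Ax; right; exists x.
Qed.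

(** * The space and its partitions *)

Lemma ex_forced_points (K : Type) : infinite_set [set: K] ->
  exists N (c : set K -> point K -> bool), @thin K `<=` N /\ forced (@piece K) N c.
Proof.
move=> Kinf; have /card_eqPle[pointK _] := card_point Kinf.
have [g gS] := ex_set_code Kinf pointK.
apply: ex_forced gS.
- exact: thin_ideal.
- exact/(finite_thin Kinf)/finite_set0.
- by move=> x; exact/(finite_thin Kinf)/finite_set1.
- exact: codense_membership.
Qed.

Section Space.
Variables (K : Type) (N : set (set (point K))) (c : set K -> point K -> bool).
Hypothesis Kinf : infinite_set [set: K].
Hypothesis thinN : @thin K `<=` N.
Hypothesis DNc : forced (@piece K) N c.

Let j0 : K + nat * seq K := inr (0, [::]).

Let N0 : N set0. Proof. exact/thinN/(finite_thin Kinf)/finite_set0. Qed.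

(** The coordinates of [x] are its sides in the partitions [c i]. *)
Definition realize (x : point K) : cantor_cube (set K) := c^~ x.

Definition space : set (cantor_cube (set K)) := range realize.

Lemma realize_inj : injective realize.
Proof.
move=> x y xy; apply: contrapT => nxy.
have [i [/(_ _ erefl) iy /(_ x erefl)/(_ nxy)]] :=
  forced_sep DNc (forced_point DNc x) (forced_point DNc y).
by rewrite (congr1 (fun g : cantor_cube (set K) => g i) xy : c i x = c i y) iy.
Qed.

(** [h] is the inverse of [realize]. *)
Lemma ex_underlying : exists h : space -> point K,
  box_embedding c h /\ set_surj setT setT h.
Proof.
have /choice[h hP] : forall y : space, exists x, realize x = set_val y.
  by move=> y; have [x _ xy] := set_valP y; exists x.
exists h; split; last first.
  move=> x _; exists (SigSub (mem_set (imageP realize (Logic.I : [set: _] x)))) => //.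
  by apply: realize_inj; rewrite hP.
split.
- by move=> y z yz; apply: val_inj; rewrite -!set_valE -!hP yz.
- move=> F f; exists [set g : cantor_cube (set K) | forall i, i \in F -> g i = f i].
    exact: cube_box.
  by apply/seteqP; split=> y yF i /yF; rewrite -hP.
- move=> O y [V oV <-] Vy; have [F FV] := cube_nbhs oV Vy.
  by exists F => z zF; apply: FV => i /zF /=; rewrite -!hP.
Qed.

Lemma C_space_space : C_space space.
Proof.
have [h [he hsurj]] := ex_underlying.
have nwdP := nowhere_denseP DNc he j0 hsurj.
have large (A : set (set_type space)) : ~ nowhere_dense A -> [set: K] #<= A.
  move=> nA; apply: contrapT => KA; apply/nA/nwdP/thinN/small_thin.
  move=> /card_le_trans KhA; apply: KA; apply: KhA; exact: card_image_le.
have openN (U : set (set_type space)) : open U -> U !=set0 -> ~ nowhere_dense U.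
  move=> oU [y Uy] Unwd; suff : (closure U)° y by rewrite Unwd.
  rewrite /interior nbhsE; exists U; first by split.
  exact: subset_closure.
have spaceK : space #= [set: K].
  apply: card_eq_trans (card_point Kinf); apply: inj_card_eq => x y _ _.
  exact: realize_inj.
have spaceTK : [set: space] #= [set: K].
  exact: card_eq_trans (card_setT _) spaceK.
have spaceT0 : [set: space] !=set0.
  by have [y _ _] := hsurj (Point [::] [::] 0 (inr 0) [::]) Logic.I; exists y.
split=> //.
- move=> O [g Og] oO; have [F FO] := cube_nbhs oO Og.
  have [x [xF _ _]] := forced_codense DNc F g j0 N0.
  by exists (realize x); split; [exact: FO|exists x].
- move=> A /nwdP NA; suff -> : A = h @^-1` (h @` A).
    exact: (ideal_closed DNc he NA).
  by apply/seteqP; split=> [y Ay|y [z Az /(be_inj he) <-]] //; exists y.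
- split; last exact: large.
  by exists setT => //; apply: openN => //; exact: openT.
- split; first by exists setT => //; split=> //; exact: openT.
  by move=> U [oU U0]; apply/large/openN.
Qed.

(** The [n]-th part is the root of the [n]-th tree, to which the points of level
    [n] that lie in no tree are added. *)
Lemma resolvable_partition : exists P : nat -> set space,
  partition [set: nat] P [set: space] /\
  (forall n, dense (P n) /\ hereditarily_resolvable (set_type (P n)) K).
Proof.
have [h [he hsurj]] := ex_underlying.
have hS x : exists y, h y = x by have [y _ <-] := hsurj x Logic.I; exists y.
pose R n := [set x : point K | kind x = inr n \/
                               (exists k, kind x = inl k) /\ level x = n].
have RD n : R n `\` piece (inr (n, [::])) `<=` [set x | level x = n].
  by move=> x [[xn nx|[_ //]]]; case: nx; split=> //; exists (tail x).
have denseR n : dense (h @^-1` R n).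
  apply: (dense_from DNc he (j := inr (n, [::])) N0) => x [xn _].
  by left; have [y yx] := hS x; exists y => //; left; rewrite /= yx.
exists (fun n => h @^-1` R n); split; first split.
- apply/seteqP; split=> // y _; case E : (kind (h y)) => [k|n].
    by exists (level (h y)) => //; right; split=> //; exists k.
  by exists n => //; left.
- move=> m n _ _ [y [[ym|[[k yk] ym]] [yn|[[l yl] yn]]]].
  + by move: ym; rewrite yn => -[].
  + by move: ym; rewrite yl.
  + by move: yn; rewrite yk.
  + by rewrite -ym -yn.
- move=> n _; have [y yx] := hS (Point [::] [::] 0 (inr n) [::]).
  by exists y; left; rewrite /= yx.
move=> n; split=> // A _ Acr.
have ge := box_embedding_sub A (box_embedding_sub (h @^-1` R n) he).
apply: (resolvable_of_split DNc ge (j := inr (n, [::]))) => //.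
  apply: (forced_ideal DNc).1 (thinN (level_thin n Kinf)).
  move=> x [[y _ <-] nx]; apply: RD; split=> //.
  exact: (set_valP (set_val y)).
move=> [k|[m s]] x [/= xn _]; first by rewrite xn.
move=> [/= xm _]; exists (fun k => inr (m, s ++ [:: k])); split.
  move=> k z [zm [t zt]]; split=> //; exists (k :: t).
  by rewrite zt -catA.
move=> k k' _ _ [z [[_ [t zt]] [_ [t' zt']]]].
move: zt; rewrite zt' -!catA => /(congr1 (drop (size s))).
by rewrite !drop_size_cat// => -[].
Qed.

(** Embed [M] in [K] by [i] and [nat] in [M] by [u]. The part of index [m] is the
    set of points of kind [i m], to which those points of level [n] are added,
    if [m = u n], that belong to none of the sets so chosen. *)
Lemma submaximal_partition (M : Type) :
  infinite_set [set: M] -> [set: M] #<= [set: K] ->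
  exists Q : M -> set space,
    partition [set: M] Q [set: space] /\
    (forall m, [/\ dense (Q m), submaximal (set_type (Q m)) &
                   hereditarily_irresolvable (set_type (Q m))]).
Proof.
move=> /infiniteP/card_leT_inj[u uinj] /card_leT_inj[i iinj].
have [h [he hsurj]] := ex_underlying.
have hS x : exists y, h y = x by have [y _ <-] := hsurj x Logic.I; exists y.
pose R m := [set x : point K | kind x = inl (i m) \/
  (forall m', kind x <> inl (i m')) /\ u (level x) = m].
have RD m : N (R m `\` piece (inl (i m))).
  have [[n nm]|nou] := pselect (exists n, u n = m).
    apply: (forced_ideal DNc).1 (thinN (level_thin n Kinf)).
    by move=> x [[//|[_]]]; rewrite -nm => /uinj.
  apply: (forced_ideal DNc).1 N0.
  by move=> x [[//|[_ xm]]] _; apply: nou; exists (level x).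
have denseR m : dense (h @^-1` R m).
  apply: (dense_from DNc he (j := inl (i m)) N0) => x xm.
  by left; have [y yx] := hS x; exists y => //; left; rewrite /= yx.
exists (fun m => h @^-1` R m); split; first split.
- apply/seteqP; split=> // y _.
  have [[m ym]|nom] := pselect (exists m, kind (h y) = inl (i m)).
    by exists m => //; left.
  exists (u (level (h y))) => //; right; split=> // m ym.
  by apply: nom; exists m.
- move=> m n _ _ [y [[ym|[nom ym]] [yn|[non yn]]]].
  + by move: ym; rewrite yn => -[/iinj].
  + by case: (non m).
  + by case: (nom n).
  + by rewrite -ym -yn.
- move=> m _; have [y yx] := hS (Point [::] [::] 0 (inl (i m)) [::]).
  by exists y; left; rewrite /= yx.
move=> m; suff Qsub : submaximal (set_type (h @^-1` R m)).
  by split=> //; exact: submaximal_hered_irresolvable.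
have ge := box_embedding_sub (h @^-1` R m) he.
apply: (submaximal_of_single DNc ge (j := inl (i m))).
- apply: (forced_ideal DNc).1 (RD m) => x [[y _ <-] nx]; split=> //.
  exact: (set_valP y).
- move=> [k|[n s]] x /= xm; first by rewrite xm => -[->].
  by case; rewrite xm.
Qed.

End Space.

Theorem theorem4p9 (K : Type) (K_infinite : infinite_set [set: K]) :
  exists X : set (cantor_cube (set K)),
    [/\ C_space X,
        exists P : nat -> set (set_type X),
          partition [set: nat] P [set: set_type X] /\
          (forall n, dense (P n) /\
                     hereditarily_resolvable (set_type (P n)) K) &
        forall M : Type, infinite_set [set: M] -> [set: M] #<= [set: K] ->
          exists Q : M -> set (set_type X),
            partition [set: M] Q [set: set_type X] /\
            (forall m, [/\ dense (Q m),
                           submaximal (set_type (Q m)) &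
                           hereditarily_irresolvable (set_type (Q m))])].
Proof.
have [N [c [thinN DNc]]] := ex_forced_points K_infinite.
exists (space c); split.
- exact: C_space_space K_infinite thinN DNc.
- exact: resolvable_partition K_infinite thinN DNc.
- by move=> M; exact: submaximal_partition K_infinite thinN DNc M.
Qed.
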